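(* The following are equivalent for a theory $T$: (1) $T$ is dp-minimal. (2) If $(\bar a_i)_{i\in I}$ is an indiscernible sequence and $c$ is an element, then there is a partition of $I$ into finitely many convex sets $I_0,\dots,I_n$, at most two of which are infinite, so that for any $0\le l\le n$, if $i,j\in I_l$ then $\mathrm{tp}(\bar a_i/c)=\mathrm{tp}(\bar a_j/c)$. (3) If $(\bar a_i)_{i\in I}$ is an indiscernible sequence and $c$ is an element, then there is a partition of $I$ into finitely many convex sets $I_0,\dots,I_n$, at most two of which are infinite, so that for any $0\le l\le n$ the sequence $(\bar a_i)_{i\in I_l}$ is indiscernible over $c$.
   Context: $T$ is a complete theory; elements and sequences are taken in a monster model of $T$. $I$ ranges over arbitrary linear orders, indiscernible sequences are sequences of finite tuples of a fixed length, and $c$ is a single element (a $1$-tuple). An ICT pattern in a structure $M$ consists of formulae $\phi(x,\bar y)$, $\psi(x,\bar y)$, with $x$ a single variable and $\bar y$ a finite tuple of variables, and sequences $(\bar a_i)_{i\in\omega}$, $(\bar b_i)_{i\in\omega}$ of tuples from $M$ such that for all $i,j\in\omega$ the set $\{\phi(x,\bar a_i),\psi(x,\bar b_j)\}\cup\{\neg\phi(x,\bar a_l):l\neq i\}\cup\{\neg\psi(x,\bar b_k):k\neq j\}$ is consistent (realized in some elementary extension of $M$). A theory is dp-minimal if there is no ICT pattern in any of its models. *)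

(* Defs.v *)
From mathcomp Require Import all_boot all_order.
From mathcomp Require Import boolp classical_sets functions cardinality.
From Stdlib Require List.

Set Implicit Arguments.
Unset Strict Implicit.
Unset Printing Implicit Defensive.

Local Open Scope classical_set_scope.

Record language := Language {
  fsym : Type;
  far : fsym -> nat;
  rsym : Type;
  rar : rsym -> nat
}.

Inductive term (L : language) (V : Type) : Type :=
| Var of V
| App (f : fsym L) of ('I_(far f) -> term L V).

(* [formula L V] has its free variables in [V]. Under [All] the bound variable
   is [None], so a formula phi(x, y_0, ..., y_(m-1)) with a distinguished
   single variable x has type [formula L (option 'I_m)], x being [None]. *)
Inductive formula (L : language) (V : Type) : Type :=
| Bot
| Equ of term L V & term L V
| Rel (r : rsym L) of ('I_(rar r) -> term L V)
| Imp of formula L V & formula L V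
| All of formula L (option V).

Arguments Bot {L V}.

Definition Neg L V (phi : formula L V) : formula L V := Imp phi Bot.

Record structure (L : language) := Structure {
  carrier :> Type;
  carrier_inhabited : inhabited carrier;
  fint : forall f : fsym L, ('I_(far f) -> carrier) -> carrier;
  rint : forall r : rsym L, ('I_(rar r) -> carrier) -> Prop
}.

Fixpoint eval L (M : structure L) V (v : V -> M) (t : term L V) : M :=
  match t with
  | Var x => v x
  | App f ts => fint (fun k => eval v (ts k))
  end.

Fixpoint sat L (M : structure L) V (v : V -> M) (phi : formula L V) : Prop :=
  match phi with
  | Bot => False
  | Equ t u => eval v t = eval v u
  | Rel r ts => rint (fun k => eval v (ts k))
  | Imp phi1 phi2 => sat v phi1 -> sat v phi2
  | All phi1 => forall x : M, sat (oapp v x) phi1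
  end.

Definition sentence L := formula L void.
Definition theory L := set (sentence L).

Definition models L (M : structure L) (s : sentence L) : Prop :=
  sat (of_void M) s.

Definition is_model L (T : theory L) (M : structure L) : Prop :=
  forall s, T s -> models M s.

Definition entails L (T : theory L) (s : sentence L) : Prop :=
  forall M : structure L, is_model T M -> models M s.

Definition complete L (T : theory L) : Prop :=
  (exists M : structure L, is_model T M) /\
  forall s : sentence L, entails T s \/ entails T (Neg s).

Definition elementary L (M N : structure L) (h : M -> N) : Prop :=
  forall m (phi : formula L 'I_m) (v : 'I_m -> M), sat v phi <-> sat (h \o v) phi.

Definition automorphism L (M : structure L) (h : M -> M) : Prop :=
  [/\ bijective h,
      forall (f : fsym L) (x : 'I_(far f) -> M), h (fint x) = fint (h \o x) &
      forall (r : rsym L) (x : 'I_(rar r) -> M), rint (h \o x) <-> rint x].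

(* For |K| infinite and kappa = |K|^+: kappa-saturation. Parameter sets of size
   < kappa are the ranges of the families [e : K -> M]; [None] is the variable
   of the 1-type. *)
Definition saturated (K : Type) L (M : structure L) : Prop :=
  forall (e : K -> M) (p : set (formula L (option K))),
    (forall s : seq (formula L (option K)), List.Forall p s ->
       exists x : M, List.Forall (sat (oapp e x)) s) ->
    exists x : M, forall phi, p phi -> sat (oapp e x) phi.

(* Strong kappa-homogeneity, with kappa = |K|^+ as above. *)
Definition strongly_homogeneous (K : Type) L (M : structure L) : Prop :=
  forall e e' : K -> M,
    (forall phi : formula L K, sat e phi <-> sat e' phi) ->
    exists2 h : M -> M, automorphism h & h \o e = e'.

(* A monster model of T: kappa-saturated and strongly kappa-homogeneous, where
   kappa = |K|^+ and |K| >= |L| + aleph_0. *)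
Definition monster (K : Type) L (T : theory L) (U : structure L) : Prop :=
  [/\ [/\ exists g : nat -> K, injective g,
          exists g : fsym L -> K, injective g &
          exists g : rsym L -> K, injective g],
      is_model T U,
      saturated K U &
      strongly_homogeneous K U].

Definition ICT_pattern L (M : structure L) (m : nat)
    (phi psi : formula L (option 'I_m)) (a b : nat -> 'I_m -> M) : Prop :=
  forall i j : nat, exists (N : structure L) (h : M -> N), elementary h /\
    exists x : N,
      [/\ sat (oapp (h \o a i) x) phi,
          sat (oapp (h \o b j) x) psi,
          forall l, l <> i -> ~ sat (oapp (h \o a l) x) phi &
          forall k, k <> j -> ~ sat (oapp (h \o b k) x) psi].

Definition dp_minimal L (T : theory L) : Prop :=
  forall M : structure L, is_model T M ->
    ~ exists (m : nat) (phi psi : formula L (option 'I_m))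
             (a b : nat -> 'I_m -> M), ICT_pattern phi psi a b.

Definition sum_val (V P X : Type) (v : V -> X) (e : P -> X) (z : V + P) : X :=
  match z with inl y => v y | inr p => e p end.

(* The type of the tuple [v] over the parameters enumerated by [e]. *)
Definition tp L (M : structure L) (P : Type) (e : P -> M) (V : Type)
    (v : V -> M) : set (formula L (V + P)) :=
  [set phi | sat (sum_val v e) phi].

Definition par0 L (M : structure L) : void -> M := of_void M.
Definition par1 L (M : structure L) (c : M) : unit -> M := fun=> c.

(* The subsequence (a_i)_(i in J) is indiscernible over the parameters [e]. *)
Definition indiscernible_on L (M : structure L) (P : Type) (e : P -> M)
    (d : Order.disp_t) (I : orderType d) (J : set I) (m : nat)
    (a : I -> 'I_m -> M) : Prop :=
  forall (k : nat) (s t : 'I_k -> I),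
    (forall x y : 'I_k, (x < y)%N -> (s x < s y)%O) ->
    (forall x y : 'I_k, (x < y)%N -> (t x < t y)%O) ->
    (forall x, J (s x)) -> (forall x, J (t x)) ->
    tp e (fun z : 'I_k * 'I_m => a (s z.1) z.2) =
    tp e (fun z : 'I_k * 'I_m => a (t z.1) z.2).

Definition indiscernible L (M : structure L) (d : Order.disp_t)
    (I : orderType d) (m : nat) (a : I -> 'I_m -> M) : Prop :=
  indiscernible_on (@par0 L M) [set: I] a.

Definition order_convex (d : Order.disp_t) (I : orderType d) (J : set I) : Prop :=
  forall i j k : I, J i -> J k -> (i <= j <= k)%O -> J j.

(* Empty pieces are allowed, so that the empty order has such a partition; for
   nonempty I they can be discarded. *)
Definition convex_partition (d : Order.disp_t) (I : orderType d) (n : nat)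
    (Q : 'I_n.+1 -> set I) : Prop :=
  [/\ cover [set: 'I_n.+1] Q = [set: I],
      trivIset [set: 'I_n.+1] Q &
      forall l, order_convex (Q l)].

Definition at_most_two_infinite (T : Type) (n : nat) (Q : 'I_n.+1 -> set T) : Prop :=
  (#|[set l : 'I_n.+1 | `[< infinite_set (Q l) >]]%SET| <= 2)%N.

(* Main.v *)
Require Import Defs.
From mathcomp Require Import all_boot all_order.
From mathcomp Require Import boolp classical_sets functions cardinality.
From mathcomp Require Import zify.

Set Implicit Arguments.
Unset Strict Implicit.
Unset Printing Implicit Defensive.

Import Order.TTheory.

Local Open Scope classical_set_scope.

(** The condition on types gives back dp-minimality, and dp-minimality gives the
    stronger condition on indiscernible subsequences, which implies the one on
    types; so two constructions suffice.

    Suppose that an ICT pattern exists. Ramsey's theorem and compactness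
    ([ICT_indiscernible]) turn it into one indiscernible sequence in the monster
    model, whose terms are pairs of tuples and whose index set is the ordered
    product [nat *l nat], together with an element [c] such that the first
    formula holds of [c] and the first half of the term only at the index
    [(1, 0)], and the second formula with the second half only at [(2, 0)].
    Each of these two indices is then alone in its piece of a convex partition
    into types over [c]. They leave three infinite intervals, and pieces that
    meet different intervals are different, so at least three pieces are
    infinite.

    Conversely, let [T] be dp-minimal. The key fact is [no_two_changes]: for an
    indiscernible sequence [b] there are no [i1 < i2 < j1 < j2] such that one
    formula over [c] distinguishes the terms [i1] and [i2] and another one the
    terms [j1] and [j2]. By indiscernibility such changes can be placed
    anywhere; since [T] has no independence property, formulas are constant on
    long runs between them; and then the formulas saying that a pair of terms is
    distinguished have ICT patterns of every finite size, hence, by compactness,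
    an infinite one. A sequence of blocks extends this from single terms to
    tuples of terms ([no_two_tuple_changes]): two disjoint segments of an infinite
    index order cannot both fail to be indiscernible over [c]. Therefore the
    largest initial and the largest final segment that are indiscernible over
    [c] cover all but at most one index, and three pieces are enough. If the index order is
    finite, singletons will do.

    Saturation concerns types in one variable over few parameters, whereas the
    arguments above need types in countably many variables; [realize] makes the
    passage, and it also transfers satisfiability from any model of [T] to the
    monster model. *)

(** * Renaming, free variables and connectives *)

Fixpoint tmap L (V W : Type) (f : V -> W) (t : term L V) : term L W :=
  match t with
  | Var x => Var L (f x)
  | App g ts => App (fun k => tmap f (ts k))
  end.

Fixpoint fmap L (V : Type) (p : formula L V) : forall W : Type, (V -> W) -> formula L W :=
  match p with
  | Bot => fun _ _ => Bot
  | Equ t u => fun _ f => Equ (tmap f t) (tmap f u)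
  | Rel r ts => fun _ f => Rel (fun k => tmap f (ts k))
  | Imp p1 p2 => fun _ f => Imp (fmap p1 f) (fmap p2 f)
  | All p1 => fun _ f => All (fmap p1 (omap f))
  end.

Lemma eval_tmap L (M : structure L) (V W : Type) (f : V -> W) (v : W -> M) (t : term L V) :
  eval v (tmap f t) = eval (v \o f) t.
Proof. by elim: t => //= g ts IH; congr fint; apply: funext => k; exact: IH. Qed.

Lemma sat_fmap L (M : structure L) (V : Type) (p : formula L V) (W : Type) (f : V -> W)
    (v : W -> M) :
  sat v (fmap p f) = sat (v \o f) p.
Proof.
elim: p W f v => {V} [V|V t u|V r ts|V p1 IH1 p2 IH2|V p1 IH] W f v //=.
- by rewrite !eval_tmap.
- by congr rint; apply: funext => k; rewrite eval_tmap.
- by rewrite IH1 IH2.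
- apply: eq_forall => x; rewrite IH; congr (sat _ p1).
  by apply: funext => -[].
Qed.

Fixpoint tvars L (V : Type) (t : term L V) : seq V :=
  match t with
  | Var x => [:: x]
  | App g ts => flatten [seq tvars (ts k) | k <- enum 'I_(far g)]
  end.

Fixpoint fvars L (V : Type) (p : formula L V) : seq V :=
  match p with
  | Bot => [::]
  | Equ t u => tvars t ++ tvars u
  | Rel r ts => flatten [seq tvars (ts k) | k <- enum 'I_(rar r)]
  | Imp p1 p2 => fvars p1 ++ fvars p2
  | All p1 => pmap id (fvars p1)
  end.

Lemma In_flatten_enum (V : Type) n (F : 'I_n -> seq V) k x :
  List.In x (F k) -> List.In x (flatten [seq F k | k <- enum 'I_n]).
Proof.
have: k \in enum 'I_n by rewrite mem_enum.
elim: (enum _) => // i s IH; rewrite in_cons => /orP hk hx.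
apply: List.in_or_app; case: hk => [/eqP <-|/IH H]; first by left.
by right; exact: H.
Qed.

Lemma In_pmap_id (V : Type) (s : seq (option V)) x :
  List.In (Some x) s -> List.In x (pmap id s).
Proof.
elim: s => //= -[y|] s IH [] //=.
- by case=> ->; left.
- by move/IH; right.
Qed.

Lemma eval_eq L (M : structure L) (V : Type) (v w : V -> M) (t : term L V) :
  (forall x, List.In x (tvars t) -> v x = w x) -> eval v t = eval w t.
Proof.
elim: t => [x|g ts IH] /= h; first by apply: h; left.
congr fint; apply: funext => k; apply: IH => x hx; apply: h.
exact: (@In_flatten_enum _ _ (fun k => tvars (ts k)) k).
Qed.

Lemma sat_eq L (M : structure L) (V : Type) (p : formula L V) (v w : V -> M) :
  (forall x, List.In x (fvars p) -> v x = w x) -> sat v p = sat w p.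
Proof.
elim: p v w => {V} [V|V t u|V r ts|V p1 IH1 p2 IH2|V p1 IH] v w //= h.
- by congr (_ = _); apply: eval_eq => x hx; apply: h;
    apply: List.in_or_app; [left|right].
- congr rint; apply: funext => k; apply: eval_eq => x hx; apply: h.
  exact: (@In_flatten_enum _ _ (fun k => tvars (ts k)) k).
- rewrite (IH1 v w) ?(IH2 v w) // => x hx; apply: h;
    apply: List.in_or_app; [by right|by left].
- apply: eq_forall => a; apply: IH => -[x|] //= hx.
  by apply: h; exact: In_pmap_id.
Qed.

Lemma fvars_bounded L (p : formula L nat) :
  exists B, forall (M : structure L) (v w : nat -> M),
    (forall i, (i < B)%N -> v i = w i) -> sat v p = sat w p.
Proof.
have [B hB] : exists B, forall x, List.In x (fvars p) -> (x < B)%N.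
  elim: (fvars p) => [|y s [B hB]]; first by exists 0%N.
  exists (maxn y.+1 B) => x /= [<-|/hB]; lia.
by exists B => M v w h; apply: sat_eq => x /hB; exact: h.
Qed.

(** Encoded by implications only, as [(p1 -> ... -> pn -> Bot) -> Bot]. *)
Definition Conj L (V : Type) (s : seq (formula L V)) : formula L V :=
  Neg (foldr (fun p q => Imp p q) Bot s).

Lemma sat_Neg L (M : structure L) (V : Type) (v : V -> M) p : sat v (Neg p) = ~ sat v p.
Proof. by []. Qed.

Lemma sat_All L (M : structure L) (V : Type) (v : V -> M) p :
  sat v (All p) = forall x : M, sat (oapp v x) p.
Proof. by []. Qed.

Lemma sat_Conj L (M : structure L) (V : Type) (v : V -> M) (s : seq (formula L V)) :
  sat v (Conj s) = List.Forall (sat v) s.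
Proof.
rewrite /Conj sat_Neg; elim: s => [|p s IH] /=; apply/propext; split.
- by [].
- by move=> _ h; apply: h.
- move=> h; constructor; first by apply: contrapT => np; apply: h.
  by rewrite -IH => h2; apply: h.
- by move=> /List.Forall_cons_iff [h1]; rewrite -IH => h2 h3; apply: h2; exact: h3.
Qed.

Definition Iff L (V : Type) (p q : formula L V) : formula L V :=
  Conj [:: Imp p q; Imp q p].

Lemma sat_Iff L (M : structure L) (V : Type) (v : V -> M) (p q : formula L V) :
  sat v (Iff p q) = (sat v p <-> sat v q).
Proof.
rewrite /Iff sat_Conj; apply/propext; split.
  by rewrite !List.Forall_cons_iff => -[h1 [h2 _]].
by move=> [h1 h2]; do !constructor.
Qed.

Definition Ex L (V : Type) (p : formula L (option V)) : formula L V := Neg (All (Neg p)).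

Lemma sat_Ex L (M : structure L) (V : Type) (v : V -> M) (p : formula L (option V)) :
  sat v (Ex p) = exists x, sat (oapp v x) p.
Proof.
apply/propext; split => /= [h|[x hx] h]; last exact: (h x).
by apply: contrapT => h'; apply: h => x hx; apply: h'; exists x.
Qed.

(** The existential closure of [p] over the variables from [n] to [n + d - 1]. *)
Fixpoint exs L (n d : nat) (p : formula L nat) : formula L nat :=
  if d is d'.+1 then
    Ex (fmap (exs n.+1 d' p) (fun j => if j == n then None else Some j))
  else p.

Lemma sat_exs L (M : structure L) n d (p : formula L nat) (v : nat -> M) :
  sat v (exs n d p) <->
  exists2 w, (forall i, (i < n)%N || (n + d <= i)%N -> w i = v i) & sat w p.
Proof.
elim: d n v => [|d IH] n v.
  rewrite /=; split=> [h|[w hw]]; first by exists v.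
  by suff -> : w = v by []; apply: funext => i; apply: hw; lia.
rewrite sat_Ex; split=> [[x]|[w hw h]].
  rewrite sat_fmap => /IH [w hw h]; exists w => // i hi.
  rewrite hw /=; last by lia.
  by case: eqP hi => // ->; lia.
exists (w n); rewrite sat_fmap; apply/IH; exists w => // i hi /=.
by case: eqP hi => [->|ne hi] //=; apply: hw; lia.
Qed.

(** If [B] bounds the free variables of [p], then quantifying [B] variables from
    [n] on leaves none of the free variables from [n] on, so the given assignment
    matters only below [n]. *)
Lemma sat_exs_bounded L (p : formula L nat) B
    (hB : forall (M : structure L) (v w : nat -> M),
      (forall i, (i < B)%N -> v i = w i) -> sat v p = sat w p)
    n (M : structure L) (v : nat -> M) :
  sat v (exs n B p) <-> exists2 w, (forall i, (i < n)%N -> w i = v i) & sat w p.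
Proof.
rewrite sat_exs; split=> -[w hw h].
  by exists w => // i hi; apply: hw; rewrite hi.
exists (fun i => if (i < n + B)%N then w i else v i).
  by move=> i /orP [hi|hi]; case: ltnP; move=> // hi'; [apply: hw|lia].
by rewrite -(hB _ w) // => i hi; case: ltnP => //; lia.
Qed.

(** * Countable types are realised in the monster model *)

Lemma Forall_exists (A B : Type) (P : A -> Prop) (R : A -> B -> Prop) (s : seq A) :
  (forall a, P a -> exists b, R a b) -> List.Forall P s ->
  exists t : seq B, List.Forall2 R s t.
Proof.
move=> h; elim: s => [|a s IH]; first by exists [::].
by move=> /List.Forall_cons_iff [/h [b hb] /IH [t ht]]; exists (b :: t); constructor.
Qed.

Lemma Forall_directed (D A : Type) (P : D -> A -> Prop) (d0 : D) (join : D -> D -> D)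
    (s : seq A) :
  (forall d d' a, P d a -> P (join d d') a) ->
  (forall d d' a, P d' a -> P (join d d') a) ->
  List.Forall (fun a => exists d, P d a) s -> exists d, List.Forall (P d) s.
Proof.
move=> monol monor; elim: s => [|a s IH]; first by exists d0.
move=> /List.Forall_cons_iff [[d ha] /IH [d' hs]]; exists (join d d').
constructor; first exact: monol.
by apply: List.Forall_impl hs => x; exact: monor.
Qed.

Lemma Forall_chain (A : Type) (P : nat -> A -> Prop) (s : seq A) :
  (forall n n' a, (n <= n')%N -> P n a -> P n' a) ->
  List.Forall (fun a => exists n, P n a) s -> exists n, List.Forall (P n) s.
Proof.
move=> mono; apply: (@Forall_directed _ _ P 0%N maxn) => n n' a; apply: mono.
  by rewrite leq_maxl.
by rewrite leq_maxr.
Qed.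

Section Monster.
Variables (L : language) (T : theory L) (Tcomplete : complete T).
Variables (K : Type) (U : structure L) (monsterU : monster K T U).

Lemma model_sentence (M : structure L) (s : sentence L) :
  is_model T M -> models M s -> models U s.
Proof.
move=> hM hs; case: monsterU => _ hU _ _; case: Tcomplete => _ /(_ s) [h|h].
  exact: h.
by case: (h M hM hs).
Qed.

(** Saturation is about types in one variable, so the values are chosen one by
    one: before step [n], every finite part of [Sig] can be satisfied with the
    first [n] values already chosen, and the 1-type realised at that step says
    that this persists. *)
Lemma realize_nat (Sig : set (formula L nat)) :
  (forall l, List.Forall Sig l -> exists (M : structure L) (v : nat -> M),
      is_model T M /\ List.Forall (sat v) l) ->
  exists v : nat -> U, forall p, Sig p -> sat v p.
Proof.
move=> fsat.
have [[[g ginj] _ _] hU Usat _] := monsterU.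
pose Q n (v : nat -> U) l (x : U) := exists w : nat -> U,
  [/\ forall i, (i < n)%N -> w i = v i, w n = x & List.Forall (sat w) l].
pose P n (v : nat -> U) := forall l, List.Forall Sig l -> exists x, Q n v l x.
have P0 (v : nat -> U) : P 0%N v.
  move=> l /fsat [M [w [hM hw]]].
  have [B hB] := fvars_bounded (Conj l).
  pose s : sentence L := All (fmap (exs 0 B (Conj l)) (fun=> None)).
  have : models U s.
    apply: (model_sentence hM); rewrite /models /s sat_All => x.
    rewrite sat_fmap; apply/(sat_exs_bounded hB).
    by exists w => //; rewrite sat_Conj.
  rewrite /models /s sat_All => /(_ (v 0%N)); rewrite sat_fmap => /(sat_exs_bounded hB) [u _].
  by rewrite sat_Conj => hu; exists (u 0%N), u.
have step n v : P n v ->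
    exists v', (forall i, (i < n)%N -> v' i = v i) /\ P n.+1 v'.
  move=> hP.
  have [e he] : exists e : K -> U, forall i, e (g i) = v i.
    exists (fun k => if pselect (exists i, g i = k) is left h
                     then v (projT1 (cid h)) else v 0%N) => i.
    case: pselect => [h|[]]; last by exists i.
    by congr v; apply: ginj; case: cid.
  (* the 1-type of the possible next values *)
  pose p (f : formula L (option K)) := exists2 l, List.Forall Sig l &
    forall x, sat (oapp e x) f <-> Q n v l x.
  have [x hx] : exists x, forall f, p f -> sat (oapp e x) f.
    apply: Usat => s hs.
    suff [l hl hQ] : exists2 l, List.Forall Sig l &
        forall x, Q n v l x -> List.Forall (sat (oapp e x)) s.
      by have [x /hQ] := hP _ hl; exists x.
    elim: s hs => [|f s IH]; first by exists [::].
    move=> /List.Forall_cons_iff [[l1 h1 H1] /IH [l2 h2 H2]].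
    exists (l1 ++ l2); first by apply/List.Forall_app.
    move=> x [w [hw1 hw2 /List.Forall_app [hw3 hw4]]]; constructor.
      by apply/H1; exists w.
    by apply/H2; exists w.
  exists (fun i => if (i < n)%N then v i else x); split=> [i ->//|l hl].
  have [B hB] := fvars_bounded (Conj l).
  pose f := fmap (exs n.+1 B (Conj l)) (fun j => if (j < n)%N then Some (g j) else None).
  have fE z : sat (oapp e z) f <-> Q n v l z.
    rewrite sat_fmap (sat_exs_bounded hB); split=> [[w hw]|[w [hw1 hw2 hw3]]].
      rewrite sat_Conj => hl'; exists w; split=> //; last by rewrite hw //= ltnn.
      by move=> i hi; rewrite hw /= ?hi //= ltnW.
    exists w; last by rewrite sat_Conj.
    move=> i hi /=; case: ltnP => hin /=; first by rewrite he hw1.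
    by rewrite -hw2; congr w; lia.
  have /hx /fE [w [hw1 hw2 hw3]] : p f by exists l.
  exists (w n.+1), w; split=> // i hi.
  case: ltnP => hin; first by rewrite hw1.
  by rewrite -hw2; congr w; lia.
have [u0] : inhabited U by exact: carrier_inhabited.
have [F hF] : {F : nat -> (nat -> U) -> nat -> U | forall n v, P n v ->
    (forall i, (i < n)%N -> F n v i = v i) /\ P n.+1 (F n v)}.
  apply: cid; suff h n v : exists v', P n v ->
      (forall i, (i < n)%N -> v' i = v i) /\ P n.+1 v'.
    exists (fun n v => projT1 (cid (h n v))) => n v; exact: (projT2 (cid (h n v))).
  case: (pselect (P n v)) => [/step [v' hv']|nP]; first by exists v'.
  by exists v => /nP.
pose V := fix V n := if n is n'.+1 then F n' (V n') else fun=> u0.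
have PV n : P n (V n) by elim: n => [|n IH]; [exact: P0|case: (hF _ _ IH)].
have VS n i : (i < n)%N -> V n i = V i.+1 i.
  elim: n => // n IH; rewrite ltnS leq_eqVlt => /orP [/eqP -> //|hi].
  by rewrite /= (hF _ _ (PV n)).1 // IH.
exists (fun i => V i.+1 i) => p hp.
have [B hB] := fvars_bounded p.
have /(PV B) [x [w [hw _ hwp]]] : List.Forall Sig [:: p] by do !constructor.
have : sat w p by move/List.Forall_cons_iff: hwp => -[].
by rewrite (hB _ w (fun i => V i.+1 i)) // => i hi; rewrite hw // VS.
Qed.

Lemma realize (W : countType) (Sig : set (formula L W)) :
  (forall l, List.Forall Sig l -> exists (M : structure L) (v : W -> M),
      is_model T M /\ List.Forall (sat v) l) ->
  exists v : W -> U, forall p, Sig p -> sat v p.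
Proof.
move=> fsat.
have [|v hv] := @realize_nat [set q | exists2 p, Sig p & q = fmap p pickle].
  move=> l' hl'.
  have [l hl] : exists l, List.Forall2 (fun q p => Sig p /\ q = fmap p pickle) l' l.
    by apply: Forall_exists hl' => q [p hp ->]; exists p.
  have /fsat [M [v [hM hv]]] : List.Forall Sig l by elim: hl => // *; constructor; tauto.
  have [m0] := carrier_inhabited M.
  exists M, (fun n => oapp v m0 (unpickle n)); split=> //.
  elim: hl hv => [|q p s t [_ ->] _ IH]; first by constructor.
  move=> /List.Forall_cons_iff [hp /IH]; constructor=> //.
  rewrite sat_fmap.
  suff -> : (fun n => oapp v m0 (unpickle n)) \o pickle = v by [].
  by apply: funext => x /=; rewrite pickleK.
exists (v \o pickle) => p hp; rewrite -sat_fmap; apply: hv; by exists p.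
Qed.
End Monster.

Definition ConjF L (V : Type) (H : finType) (F : H -> formula L V) : formula L V :=
  Conj [seq F h | h <- enum H].

Lemma sat_ConjF L (M : structure L) (V : Type) (v : V -> M) (H : finType)
    (F : H -> formula L V) :
  sat v (ConjF F) = forall h, sat v (F h).
Proof.
rewrite sat_Conj; apply/propext; split=> [hF h|hF].
  move/List.Forall_forall: hF; apply; apply/List.in_map_iff; exists h; split=> //.
  have : h \in enum H by rewrite mem_enum.
  elim: (enum H) => // i s IH; rewrite in_cons => /orP [/eqP ->|/IH]; first by left.
  by right.
by apply/List.Forall_forall => p /List.in_map_iff [h [<- _]].
Qed.

(** * Order types of indices *)

Definition increasing (d : Order.disp_t) (I : orderType d) k (s : 'I_k -> I) : Prop :=
  forall x y : 'I_k, (x < y)%N -> (s x < s y)%O.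

Lemma increasing_lt (d : Order.disp_t) (I : orderType d) k (s : 'I_k -> I) :
  increasing s -> forall x y, (s x < s y)%O = (x < y)%N.
Proof.
move=> hs x y; case: (ltngtP x y) => [/hs //|/hs h|/val_inj ->].
  by apply/negbTE; rewrite -leNgt ltW.
by rewrite ltxx.
Qed.

(** [a] and [b] are indiscernible and have the same Ehrenfeucht-Mostowski type,
    provided that both orders are infinite; [same_em a a] is indiscernibility of
    [a] over the empty set. *)
Definition same_em L (M : structure L) (d d' : Order.disp_t) (I : orderType d)
    (J : orderType d') (V : Type) (a : I -> V -> M) (b : J -> V -> M) : Prop :=
  forall k (p : formula L ('I_k * V)) (s : 'I_k -> I) (t : 'I_k -> J),
    increasing s -> increasing t ->
    sat (fun z => a (s z.1) z.2) p = sat (fun z => b (t z.1) z.2) p.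

(** In an indiscernible sequence the order pattern of a finite family of indices
    determines its type: list the distinct indices increasingly, and substitute
    variables. The form with families, not necessarily increasing or injective,
    spares the sorting in the applications. *)
Lemma order_transfer L (M : structure L) (d d' : Order.disp_t) (I : orderType d)
    (J : orderType d') (V : Type) (a : I -> V -> M) (b : J -> V -> M)
    (Z : finType) (s : Z -> I) (t : Z -> J) (p : formula L (Z * V)) :
  same_em a b -> (forall z z', (s z < s z')%O = (t z < t z')%O) ->
  sat (fun z => a (s z.1) z.2) p = sat (fun z => b (t z.1) z.2) p.
Proof.
move=> hab hst.
pose X := sort <=%O (undup (codom s)).
pose E := tnth (in_tuple X).
have Xin z : s z \in X by rewrite mem_sort mem_undup codom_f.
have Xs : sorted <%O X by rewrite sort_lt_sorted undup_uniq.
have [sg sgE] : {sg : Z -> 'I_(size X) | forall z, s z = E (sg z)}.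
  have h z : exists i, s z = E i by apply/tnthP; exact: Xin.
  by exists (fun z => projT1 (cid (h z))) => z; exact: (projT2 (cid (h z))).
have [ze zeE] : {ze : 'I_(size X) -> Z | forall i, s (ze i) = E i}.
  have h i : exists z, s z = E i.
    have : E i \in X by exact: mem_tnth.
    by rewrite mem_sort mem_undup => /codomP [z ->]; exists z.
  by exists (fun z => projT1 (cid (h z))) => z; exact: (projT2 (cid (h z))).
have Einc : increasing E.
  move=> x y xy; have x0 : I by exact: E x.
  rewrite /E !(tnth_nth x0) /=.
  by apply: (sorted_ltn_nth lt_trans) => //; rewrite inE ltn_ord.
have Einc' : increasing (t \o ze).
  by move=> x y xy; rewrite /= -hst !zeE; exact: Einc.
have teq z : t z = t (ze (sg z)).
  apply: le_anti; rewrite !leNgt -!hst zeE -sgE.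
  by rewrite ltxx.
have := hab _ (fmap p (fun z => (sg z.1, z.2))) _ _ Einc Einc'.
rewrite !sat_fmap /comp /=.
have -> : (fun z : Z * V => a (E (sg z.1)) z.2) = (fun z => a (s z.1) z.2).
  by apply: funext => z; rewrite sgE.
by have -> : (fun z : Z * V => b (t (ze (sg z.1))) z.2) = (fun z => b (t z.1) z.2)
  by apply: funext => z; rewrite -teq.
Qed.

(** Only finitely many formulas are carried over, together with the element
    [x], because [x] has to be quantified existentially. *)
Lemma element_transfer L (M : structure L) (d d' : Order.disp_t) (I : orderType d)
    (J : orderType d') (V : Type) (a : I -> V -> M) (b : J -> V -> M)
    (Z : finType) (s : Z -> I) (t : Z -> J)
    (H : finType) (F : H -> formula L (option (Z * V))) (x : M) :
  same_em a b -> (forall z z', (s z < s z')%O = (t z < t z')%O) ->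
  exists y, forall h, sat (oapp (fun z => b (t z.1) z.2) y) (F h) =
                      sat (oapp (fun z => a (s z.1) z.2) x) (F h).
Proof.
move=> hab hst; set v := oapp _ x.
pose G h := if pselect (sat v (F h)) then F h else Neg (F h).
have : sat (fun z => a (s z.1) z.2) (Ex (ConjF G)).
  by rewrite sat_Ex; exists x; rewrite sat_ConjF => h; rewrite /G; case: pselect.
rewrite (order_transfer _ hab hst) sat_Ex => -[y]; rewrite sat_ConjF => hy.
exists y => h; have := hy h; rewrite /G; case: pselect => hv h'.
  by apply/propext; split.
by apply/propext; split=> // /h'.
Qed.

(** * Changes of truth value along a sequence *)

(** Cut the interval into [n] consecutive blocks of length [r]. If both truth
    values occurred in every block, a point with value [S k] could be taken in
    the [k]-th one. *)
Lemma constant_run (f S : nat -> Prop) n o r :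
  (forall q : nat -> nat,
     (forall k l, (k < l < n)%N -> (q k < q l)%N) ->
     ~ forall k, (k < n)%N -> (f (q k) <-> S k)) ->
  exists2 o', (o <= o' /\ o' + r <= o + n * r)%N &
    forall k, (k < r)%N -> (f (o' + k)%N <-> f o').
Proof.
move=> hS; apply: contrapT => hno.
have h k : exists y, (k < n)%N -> (o + k * r <= y < o + k.+1 * r)%N /\ (f y <-> S k).
  case: (ltnP k n) => hk; last by exists 0%N.
  apply: contrapT => hy; apply: hno; exists (o + k * r)%N.
    by split; [lia|have : (k.+1 * r <= n * r)%N by rewrite leq_mul2r hk orbT]; lia.
  have hf y : (y < r)%N -> ~ (f (o + k * r + y)%N <-> S k).
    by move=> hyr hf; apply: hy; exists (o + k * r + y)%N => _; split=> //; lia.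
  move=> y hyr; have := hf _ hyr; have := hf 0%N; rewrite addn0 => /(_ _).
  have r0 : (0 < r)%N by lia.
  move=> /(_ r0).
  by case: (EM (f (o + k * r + y)%N)); case: (EM (f (o + k * r)%N)); case: (EM (S k)); tauto.
pose q k := projT1 (cid (h k)).
have hq k (hk : (k < n)%N) : (o + k * r <= q k < o + k.+1 * r)%N /\ (f (q k) <-> S k).
  exact: (projT2 (cid (h k)) hk).
apply: (hS q) => [k l /andP [kl ln]|k /hq [] //].
have [h1 _] := hq _ ln; have [h2 _] := hq _ (ltn_trans kl ln).
have : (k.+1 * r <= l * r)%N by rewrite leq_mul2r kl orbT.
lia.
Qed.

Section Patterns.
Variables (L : language) (T : theory L) (Tcomplete : complete T).
Variables (K : Type) (U : structure L) (monsterU : monster K T U).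
Hypothesis dpT : dp_minimal T.

(** The two sequences and the elements [x] for all pairs of indices are realised
    together, so that the ICT pattern already has its witnesses in [U]. *)
Lemma no_finite_ICT (V : finType) (phi psi : formula L (option V)) :
  ~ forall n, exists a b : nat -> V -> U, forall i j, (i < n)%N -> (j < n)%N ->
    exists x, [/\ sat (oapp (a i) x) phi, sat (oapp (b j) x) psi,
      forall l, (l < n)%N -> l <> i -> ~ sat (oapp (a l) x) phi &
      forall l, (l < n)%N -> l <> j -> ~ sat (oapp (b l) x) psi].
Proof.
move=> fin.
pose W : countType := (bool * nat * V + nat * nat)%type.
pose at_ s l i j (o : option V) : W := if o is Some z then inl (s, l, z) else inr (i, j).
pose Sig n (f : formula L W) := exists i j l, [/\ (i < n)%N, (j < n)%N, (l < n)%N &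
  [\/ f = fmap phi (at_ true i i j), f = fmap psi (at_ false j i j),
      l <> i /\ f = Neg (fmap phi (at_ true l i j)) |
      l <> j /\ f = Neg (fmap psi (at_ false l i j))]].
have [|v hv] := @realize L T Tcomplete K U monsterU W [set f | exists n, Sig n f].
  move=> l hl.
  have [|n hn] := Forall_chain _ hl.
    by move=> m m' g mm' [i [j [k [? ? ? ?]]]]; exists i, j, k; split=> //; lia.
  have [a [b hab]] := fin n; have [u0] := carrier_inhabited U.
  have h i j : exists x, (i < n)%N -> (j < n)%N ->
     [/\ sat (oapp (a i) x) phi, sat (oapp (b j) x) psi,
      forall l, (l < n)%N -> l <> i -> ~ sat (oapp (a l) x) phi &
      forall l, (l < n)%N -> l <> j -> ~ sat (oapp (b l) x) psi].
    case: (ltnP i n) => hi; last by exists u0.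
    case: (ltnP j n) => hj; last by exists u0.
    by have [x hx] := hab _ _ hi hj; exists x.
  pose X i j := projT1 (cid (h i j)).
  have hX i j (hi : (i < n)%N) (hj : (j < n)%N) := projT2 (cid (h i j)) hi hj.
  rewrite -/(X _ _) in hX.
  exists U, (fun w => match w with
    | inl (s, l, z) => if s then a l z else b l z | inr (i, j) => X i j end).
  split; first by case: monsterU.
  set v := (fun w => _).
  have vE s k i j : v \o at_ s k i j = oapp (if s then a k else b k) (X i j).
    by apply: funext => -[z|] //=; case: s.
  apply: List.Forall_impl hn => f [i [j [k [hi hj hk]]]].
  have [H1 H2 H3 H4] := hX _ _ hi hj.
  by case=> [->|->|[hki ->]|[hkj ->]]; rewrite ?sat_Neg sat_fmap vE; auto.
have vE s k i j : v \o at_ s k i j = oapp (fun z => v (inl (s, k, z))) (v (inr (i, j))).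
  by apply: funext => -[z|].
have Sin i j k f :
  [\/ f = fmap phi (at_ true i i j), f = fmap psi (at_ false j i j),
      k <> i /\ f = Neg (fmap phi (at_ true k i j)) |
      k <> j /\ f = Neg (fmap psi (at_ false k i j))] -> sat v f.
  by move=> hf; apply: hv; exists (i + j + k).+1, i, j, k; split=> //; lia.
pose ev s k (z : 'I_#|V|) := v (inl (s, k, enum_val z)).
have evE s k x (p : formula L (option V)) :
  sat (oapp (ev s k) x) (fmap p (omap enum_rank)) =
  sat (oapp (fun z => v (inl (s, k, z))) x) p.
  rewrite sat_fmap; congr (sat _ p); apply: funext => -[z|] //=.
  by rewrite /ev enum_rankK.
have hU : is_model T U by case: monsterU.
apply: (dpT hU); exists #|V|, (fmap phi (omap enum_rank)), (fmap psi (omap enum_rank)).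
exists (ev true), (ev false) => i j; exists U, id; split=> //.
exists (v (inr (i, j))); split=> [||l hl|l hl]; rewrite /= evE -vE -sat_fmap.
- by apply: (Sin i j 0%N); constructor 1.
- by apply: (Sin i j 0%N); constructor 2.
- rewrite -sat_Neg; by apply: (Sin i j l); constructor 3.
- rewrite -sat_Neg; by apply: (Sin i j l); constructor 4.
Qed.

Section Sequence.
Variables (V : finType) (b : nat -> V -> U).
Hypothesis indb : same_em b b.

Let holds (p : formula L (option V)) x k := sat (oapp (b k) x) p.

Lemma nat_transfer (phi psi : formula L (option V)) N (q r : nat -> nat) x :
  (forall k l, (k < l < N)%N -> (q k < q l)%N) ->
  (forall k l, (k < l < N)%N -> (r k < r l)%N) ->
  exists y, forall k, (k < N)%N ->
    holds phi y (r k) = holds phi x (q k) /\ holds psi y (r k) = holds psi x (q k).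
Proof.
move=> hq hr.
pose F (h : bool * 'I_N) : formula L (option ('I_N * V)) :=
  fmap (if h.1 then phi else psi) (omap (fun z => (h.2, z))).
have inc (f : nat -> nat) (hf : forall k l, (k < l < N)%N -> (f k < f l)%N) :
    increasing (fun k : 'I_N => f k).
  by move=> k l kl; rewrite ltEnat; apply: hf; rewrite kl ltn_ord.
have [|y hy] := @element_transfer _ U _ _ nat nat V b b 'I_N (fun k => q k) (fun k => r k)
                  _ F x indb.
  by move=> z z'; rewrite (increasing_lt (inc _ hq)) (increasing_lt (inc _ hr)).
exists y => k hk.
have E c z (f : nat -> nat) : sat (oapp (fun z : 'I_N * V => b (f z.1) z.2) z) (F (c, Ordinal hk)) =
    holds (if c then phi else psi) z (f k).
  by rewrite /F sat_fmap /holds; congr sat; apply: funext => -[].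
by split; [have := hy (true, Ordinal hk)|have := hy (false, Ordinal hk)]; rewrite !E.
Qed.

(** The independence property would give an ICT pattern in which both formulas
    are [phi], with the terms of even index in one sequence and those of odd
    index in the other. *)
Lemma unrealised_pattern (phi : formula L (option V)) :
  exists n (S : nat -> Prop), forall x (q : nat -> nat),
    (forall k l, (k < l < n)%N -> (q k < q l)%N) ->
    ~ forall k, (k < n)%N -> (holds phi x (q k) <-> S k).
Proof.
apply: contrapT => hno; apply: (@no_finite_ICT V phi phi) => n.
exists (fun i => b i.*2), (fun j => b j.*2.+1) => i j hi hj.
have [x [q [hq hx]]] : exists x q, (forall k l, (k < l < n.*2)%N -> (q k < q l)%N) /\
    forall k, (k < n.*2)%N -> (holds phi x (q k) <-> (k = i.*2 \/ k = j.*2.+1)).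
  apply: contrapT => h; apply: hno.
  exists n.*2, (fun k => k = i.*2 \/ k = j.*2.+1) => x q hq hx.
  by apply: h; exists x, q.
have [|y hy] := nat_transfer phi phi x hq (r := id); first by move=> k l /andP [].
have {}hy k : (k < n.*2)%N -> sat (oapp (b k) y) phi <-> (k = i.*2 \/ k = j.*2.+1).
  by move=> hk; rewrite -hx // -(hy _ hk).1.
exists y; split=> [||l hl nl|l hl nl]; rewrite hy; lia.
Qed.

(** A run for [psi] is taken inside a longer run for [phi]. *)
Lemma common_run (phi psi : formula L (option V)) r :
  exists R, forall x o, exists2 o', (o <= o' /\ o' + r <= o + R)%N &
    forall k, (k < r)%N -> (holds phi x (o' + k)%N <-> holds phi x o') /\
                           (holds psi x (o' + k)%N <-> holds psi x o').
Proof.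
have [n [S hS]] := unrealised_pattern phi.
have [n' [S' hS']] := unrealised_pattern psi.
exists (n * (n' * r))%N => x o.
have [o1 h1 c1] := @constant_run _ _ _ o (n' * r) (hS x).
have [o2 h2 c2] := @constant_run _ _ _ o1 r (hS' x).
exists o2; first by lia.
move=> k hk; split; last exact: c2.
have e : (o2 = o1 + (o2 - o1))%N by lia.
rewrite e -addnA (c1 (o2 - o1)%N); last by lia.
by rewrite (c1 (o2 - o1 + k)%N) //; lia.
Qed.

(** Spread the four indices out so that there is a long run on which both
    truth values are constant before the first change, between the two changes
    and after the second. Pairs of indices then form an ICT pattern for the
    formulas stating that [phi], respectively [psi], changes on the pair:
    in each of the two groups one pair is at the change, and the other pairs
    are in the runs. *)
Lemma no_two_changes (phi psi : formula L (option V)) x i1 i2 j1 j2 :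
  (i1 < i2 < j1)%N -> (j1 < j2)%N ->
  ~ (holds phi x i1 <-> holds phi x i2) ->
  (holds psi x j1 <-> holds psi x j2).
Proof.
move=> /andP [h12 h2j] hj chi; apply: contrapT => chj.
pose change (p : formula L (option V)) : formula L (option (bool * V)) :=
  Neg (Iff (fmap p (omap (pair false))) (fmap p (omap (pair true)))).
pose pr (k : nat) (z : bool * V) := b (k.*2 + z.1)%N z.2.
have chE p k y : sat (oapp (pr k) y) (change p) =
    ~ (holds p y k.*2 <-> holds p y k.*2.+1).
  rewrite sat_Neg sat_Iff !sat_fmap /holds.
  have e c : oapp (pr k) y \o omap (pair c) = oapp (b (k.*2 + c)%N) y.
    by apply: funext => -[].
  by rewrite !e addn0 addn1.
apply: (@no_finite_ICT (bool * V)%type (change phi) (change psi)) => n.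
exists pr, (fun k => pr (n + k)%N) => i j hi hj'.
have [R hR] := common_run phi psi (4 * n).
(* the changes are moved to [R, R + 1] and [2R + 2, 2R + 3] *)
have [y hy] : exists y, ~ (holds phi y R <-> holds phi y R.+1) /\
    ~ (holds psi y (2 * R + 2)%N <-> holds psi y (2 * R + 3)%N).
  pose q k := nth 0%N [:: i1; i2; j1; j2] k.
  pose r k := nth 0%N [:: R; R.+1; 2 * R + 2; 2 * R + 3]%N k.
  have [||y hy] := @nat_transfer phi psi 4 q r x.
  - by move=> [|[|[|[|k]]]] [|[|[|[|l]]]] //; rewrite /q /=; lia.
  - by move=> [|[|[|[|k]]]] [|[|[|[|l]]]] //; rewrite /r /=; lia.
  have := hy 0%N isT; have := hy 1%N isT; have := hy 2%N isT; have := hy 3%N isT.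
  rewrite /q /r /= => -[_ e3] [_ e2] [e1 _] [e0 _].
  by exists y; rewrite e0 e1 e2 e3.
have [o1 h1 c1] := hR y 0%N.
have [o2 h2 c2] := hR y (R + 2)%N.
have [o3 h3 c3] := hR y (2 * R + 4)%N.
pose q k :=
  if (k < i.*2)%N then o1 + k else
  if (k < i.*2 + 2)%N then R + (k - i.*2) else
  if (k < (n + j).*2)%N then o2 + k else
  if (k < (n + j).*2 + 2)%N then 2 * R + 2 + (k - (n + j).*2) else o3 + k.
have hq k l : (k < l < 4 * n)%N -> (q k < q l)%N.
  rewrite /q => hkl; do !case: (ltnP k _) => ?; do !case: (ltnP l _) => ?; lia.
have [|z hz] := nat_transfer phi psi y hq (r := id); first by move=> k l /andP [].
exists z.
have q1 k : (k < i)%N -> q k.*2 = (o1 + k.*2)%N /\ q k.*2.+1 = (o1 + k.*2.+1)%N.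
  by move=> hk; rewrite /q; do !case: ltnP => ?; lia.
have q2 k : (i < k < n + j)%N -> q k.*2 = (o2 + k.*2)%N /\ q k.*2.+1 = (o2 + k.*2.+1)%N.
  by move=> hk; rewrite /q; do !case: ltnP => ?; lia.
have q3 k : (n + j < k)%N -> q k.*2 = (o3 + k.*2)%N /\ q k.*2.+1 = (o3 + k.*2.+1)%N.
  by move=> hk; rewrite /q; do !case: ltnP => ?; lia.
have qi : q i.*2 = R /\ q i.*2.+1 = R.+1 by rewrite /q; do !case: ltnP => ?; lia.
have qj : q (n + j).*2 = (2 * R + 2)%N /\ q (n + j).*2.+1 = (2 * R + 3)%N.
  by rewrite /q; do !case: ltnP => ?; lia.
have chz p k : (p = phi \/ p = psi) -> (k < n.*2)%N -> sat (oapp (pr k) z) (change p) =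
    ~ (holds p y (q k.*2) <-> holds p y (q k.*2.+1)).
  move=> hp hk; rewrite chE.
  have [e1 e1'] := hz k.*2 ltac:(lia); have [e2 e2'] := hz k.*2.+1 ltac:(lia).
  by case: hp => ->; rewrite ?e1 ?e2 ?e1' ?e2'.
split=> [||l hl nl|l hl nl].
- by rewrite chz; [case: qi => -> ->; tauto|left|lia].
- by rewrite chz; [case: qj => -> ->; tauto|right|lia].
- rewrite chz; [|by left|lia]; apply.
  have [lt|lt] : (l < i)%N \/ (i < l)%N by lia.
    have [-> ->] := q1 _ lt.
    by have [-> _] := c1 l.*2 ltac:(lia); have [-> _] := c1 l.*2.+1 ltac:(lia).
  have [-> ->] := q2 l ltac:(lia).
  by have [-> _] := c2 l.*2 ltac:(lia); have [-> _] := c2 l.*2.+1 ltac:(lia).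
- rewrite chz; [|by right|lia]; apply.
  have [lt|lt] : (l < j)%N \/ (j < l)%N by lia.
    have [-> ->] := q2 (n + l)%N ltac:(lia).
    have [_ ->] := c2 (n + l).*2 ltac:(lia).
    by have [_ ->] := c2 (n + l).*2.+1 ltac:(lia).
  have [-> ->] := q3 (n + l)%N ltac:(lia).
  have [_ ->] := c3 (n + l).*2 ltac:(lia).
  by have [_ ->] := c3 (n + l).*2.+1 ltac:(lia).
Qed.
End Sequence.
End Patterns.

(** * Stretching *)

Lemma infinite_increasing (d : Order.disp_t) (I : orderType d) :
  infinite_set [set: I] -> forall N, exists e : nat -> I,
    forall k l, (k < l < N)%N -> (e k < e l)%O.
Proof.
move=> infI N.
have [s us sN] : exists2 s : seq I, uniq s & size s = N.
  elim: N => [|N [s us sN]]; first by exists [::].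
  have [x xs] : exists x, x \notin s.
    apply: contrapT => h; apply: infI; apply/finite_seqP; exists s.
    apply/seteqP; split=> // x _ /=; apply: contrapT => /negP hx; apply: h.
    by exists x.
  by exists (x :: s); rewrite /= ?xs ?sN.
have [x0 _] : exists x0 : I, True.
  apply: contrapT => h; apply: infI; suff -> : [set: I] = set0 by exact: finite_set0.
  by apply/seteqP; split=> // x _; apply: h; exists x.
exists (nth x0 (sort <=%O s)) => k l /andP [kl lN].
apply: (sorted_ltn_nth lt_trans) => //; rewrite ?sort_lt_sorted // inE size_sort sN //.
exact: ltn_trans lN.
Qed.

(** Embeds the elements of a finite list [X] into [nat], preserving the order. *)
Definition rank (d : Order.disp_t) (I : orderType d) (X : seq I) (i : I) : nat :=
  count (fun j => j < i)%O X.

Lemma rank_lt (d : Order.disp_t) (I : orderType d) (X : seq I) (i j : I) :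
  i \in X -> j \in X -> (rank X i < rank X j)%N = (i < j)%O.
Proof.
have mono x y : x \in X -> (x < y)%O -> (rank X x < rank X y)%N.
  rewrite /rank => xX xy; elim: X xX => // z Y IH.
  have le : (count (fun w => w < x)%O Y <= count (fun w => w < y)%O Y)%N.
    by apply: sub_count => w /= wx; exact: lt_trans xy.
  rewrite in_cons /= => /orP [/eqP <-|/IH]; first by rewrite ltxx xy add0n add1n ltnS.
  case: (ltP z x) => [zx|_]; first by rewrite (lt_trans zx xy) !add1n ltnS.
  by rewrite add0n => h; apply: leq_trans h (leq_addl _ _).
move=> iX jX; case: (ltgtP i j) => [/(mono _ _ iX)//|/(mono _ _ jX)|->]; last by rewrite ltnn.
by move=> h; apply/negbTE; rewrite -leqNgt ltnW.
Qed.

Section Stretch.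
Variables (L : language) (T : theory L) (Tcomplete : complete T).
Variables (K : Type) (U : structure L) (monsterU : monster K T U).

(** [I] need not contain an infinite increasing sequence, but it contains
    increasing tuples of every finite length, and these suffice by compactness. *)
Lemma stretch (d : Order.disp_t) (I : orderType d) (V : countType) (a : I -> V -> U) :
  infinite_set [set: I] -> same_em a a ->
  exists b : nat -> V -> U, same_em a b.
Proof.
move=> infI inda.
pose Sig N (f : formula L (nat * V)) := exists k (p : formula L ('I_k * V))
  (s : 'I_k -> I) (t : 'I_k -> nat), [/\ increasing s, increasing t,
    forall x, (t x < N)%N, sat (fun z => a (s z.1) z.2) p &
    f = fmap p (fun z => (t z.1, z.2))].
have [|v hv] := @realize L T Tcomplete K U monsterU (nat * V)%type
                  [set f | exists N, Sig N f].
  move=> l hl.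
  have [|N hN] := Forall_chain _ hl.
    move=> m m' f mm' [k [p [s [t [? ? h ? ?]]]]]; exists k, p, s, t; split=> // x.
    exact: leq_trans (h x) mm'.
  have [e he] := infinite_increasing infI N.
  exists U, (fun z => a (e z.1) z.2); split; first by case: monsterU.
  apply: List.Forall_impl hN => f [k [p [s [t [hs ht tN hp ->]]]]].
  rewrite sat_fmap /comp /= -(inda _ p s (fun x => e (t x))) //.
  by move=> x y xy; apply: he; rewrite tN andbT; exact: ht.
have vsat k (p : formula L ('I_k * V)) s t : increasing s -> increasing t ->
    sat (fun z => a (s z.1) z.2) p -> sat (fun z => v (t z.1, z.2)) p.
  move=> hs ht hp; have := hv (fmap p (fun z => (t z.1, z.2))); rewrite sat_fmap; apply.
  exists (\max_x t x).+1, k, p, s, t; split=> // x.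
  by rewrite ltnS; exact: leq_bigmax.
exists (fun n z => v (n, z)) => k p s t hs ht; apply/propext; split; first exact: vsat.
move=> hp; apply: contrapT => np.
exact: (@vsat _ (Neg p) s t hs ht np hp).
Qed.

Hypothesis dpT : dp_minimal T.

(** The indices are spread out so that there is room for a third tuple [u]
    after [s] and [t], and for [w] after [s'] and [t']. One of [s] and [t]
    disagrees with [u], one of [s'] and [t'] with [w], and these four tuples
    occupy disjoint intervals. Cutting a sequence into blocks of fixed length
    turns them into four terms of one sequence of longer tuples. *)
Lemma no_two_tuple_changes (d : Order.disp_t) (I : orderType d) (V : finType)
    (a : I -> V -> U) (c : U) (i0 : I) k l (s t : 'I_k -> I) (s' t' : 'I_l -> I)
    (phi : formula L (option ('I_k * V))) (psi : formula L (option ('I_l * V))) :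
  infinite_set [set: I] -> same_em a a ->
  increasing s -> increasing t -> increasing s' -> increasing t' ->
  (forall x, (s x <= i0)%O) -> (forall x, (t x <= i0)%O) ->
  (forall x, (i0 < s' x)%O) -> (forall x, (i0 < t' x)%O) ->
  let at_ n (r : 'I_n -> I) := oapp (fun z : 'I_n * V => a (r z.1) z.2) c in
  ~ (sat (at_ _ s) phi <-> sat (at_ _ t) phi) ->
  (sat (at_ _ s') psi <-> sat (at_ _ t') psi).
Proof.
move=> infI inda hs ht hs' ht' sl tl s'g t'g at_ chphi; apply: contrapT => chpsi.
have [b hab] := stretch infI inda.
have indb : same_em b b.
  move=> n p r r' hr hr'.
  have [e he] := infinite_increasing infI n.
  have he' : increasing (fun x : 'I_n => e x) by move=> x y xy; apply: he; rewrite xy /=.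
  by rewrite -(hab _ _ _ _ he' hr) -(hab _ _ _ _ he' hr').
pose bt y n (r : 'I_n -> nat) := oapp (fun z : 'I_n * V => b (r z.1) z.2) y.
pose Z : finType := (('I_k + 'I_k) + ('I_l + 'I_l))%type.
(* the index tuples of the four formulas *)
pose F (h : bool * bool) : formula L (option (Z * V)) :=
  if h.1 then fmap phi (omap (fun z => (inl (if h.2 then inl z.1 else inr z.1), z.2)))
  else fmap psi (omap (fun z => (inr (if h.2 then inl z.1 else inr z.1), z.2))).
pose glue (A : Type) (f1 f2 : 'I_k -> A) (f3 f4 : 'I_l -> A) (z : Z) : A :=
  match z with inl (inl x) => f1 x | inl (inr x) => f2 x
             | inr (inl x) => f3 x | inr (inr x) => f4 x end.
have transfer (d' : Order.disp_t) (J : orderType d') (a' : J -> V -> U) x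
    f1 f2 f3 f4 (g1 g2 : 'I_k -> nat) (g3 g4 : 'I_l -> nat) : same_em a' b ->
    (forall z z', (glue J f1 f2 f3 f4 z < glue J f1 f2 f3 f4 z')%O =
                  (glue nat g1 g2 g3 g4 z < glue nat g1 g2 g3 g4 z')%N) ->
    let av n (r : 'I_n -> J) := oapp (fun z : 'I_n * V => a' (r z.1) z.2) x in
    exists y, [/\ sat (bt y _ g1) phi = sat (av _ f1) phi,
                  sat (bt y _ g2) phi = sat (av _ f2) phi,
                  sat (bt y _ g3) psi = sat (av _ f3) psi &
                  sat (bt y _ g4) psi = sat (av _ f4) psi].
  move=> ha'b pat av.
  have [y hy] := @element_transfer _ _ _ _ _ nat _ _ _ Z (glue J f1 f2 f3 f4)
    (glue nat g1 g2 g3 g4) _ F x ha'b pat.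
  exists y; split.
  - have := hy (true, true); rewrite /F /= !sat_fmap => E.
    by apply: etrans (etrans E _); congr sat; apply: funext => -[].
  - have := hy (true, false); rewrite /F /= !sat_fmap => E.
    by apply: etrans (etrans E _); congr sat; apply: funext => -[].
  - have := hy (false, true); rewrite /F /= !sat_fmap => E.
    by apply: etrans (etrans E _); congr sat; apply: funext => -[].
  - have := hy (false, false); rewrite /F /= !sat_fmap => E.
    by apply: etrans (etrans E _); congr sat; apply: funext => -[].
pose X := codom (glue I s t s' t').
pose rk i := rank X i.
have rkX i : (rk i <= size X)%N by exact: count_size.
have Xin z : glue I s t s' t' z \in X by exact: codom_f.
pose N := size X.
have sX x : s x \in X by exact: (Xin (inl (inl x))).
have tX x : t x \in X by exact: (Xin (inl (inr x))).
have s'X x : s' x \in X by exact: (Xin (inr (inl x))).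
have t'X x : t' x \in X by exact: (Xin (inr (inr x))).
pose far i := (N.+1 + k + rk i)%N.
have pat1 z z' : (glue I s t s' t' z < glue I s t s' t' z')%O =
  (glue nat (rk \o s) (rk \o t) (far \o s') (far \o t') z <
   glue nat (rk \o s) (rk \o t) (far \o s') (far \o t') z')%N.
  have lo i j : i \in X -> j \in X -> (i <= i0)%O -> (i0 < j)%O ->
      ((i < j)%O = (rk i < far j)%N) /\ ((j < i)%O = (far j < rk i)%N).
    move=> iX jX ii0 i0j; have ij := le_lt_trans ii0 i0j.
    rewrite ij (lt_gtF ij) /far; have := rkX i; rewrite -/N; lia.
  have hi i j : i \in X -> j \in X -> (i < j)%O = (far i < far j)%N.
    by move=> iX jX; rewrite /far ltn_add2l -(rank_lt iX jX).
  have lo' i j : i \in X -> j \in X -> (i < j)%O = (rk i < rk j)%N.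
    by move=> iX jX; rewrite -(rank_lt iX jX).
  by case: z => [[x|x]|[x|x]]; case: z' => [[x'|x']|[x'|x']] /=;
    first [exact: lo'|exact: hi|apply: (lo _ _ _ _ _ _).1|apply: (lo _ _ _ _ _ _).2].
(* [rk] and [far] leave the indices from [N.+1] to [N + k] free for [u] *)
have [y [e1 e2 e3 e4]] := @transfer _ I a c _ _ _ _ _ _ _ _ hab pat1.
have inc_rk n (r : 'I_n -> I) : increasing r -> (forall x, r x \in X) ->
    increasing (rk \o r) /\ increasing (far \o r).
  move=> hr rX; split=> x x' /hr; rewrite -(rank_lt (rX x) (rX x')) ltEnat //.
  by rewrite /= /far ltn_add2l.
(* one of the two tuples differs from a tuple further to the right *)
have pick n (p : formula L (option ('I_n * V))) (r1 r2 u : 'I_n -> nat) :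
    ~ (sat (bt y _ r1) p <-> sat (bt y _ r2) p) ->
    exists2 r, r = r1 \/ r = r2 & ~ (sat (bt y _ r) p <-> sat (bt y _ u) p).
  move=> h; case: (pselect (sat (bt y _ r1) p <-> sat (bt y _ u) p)) => h1.
    by exists r2; [right|rewrite -h1 => h2; apply: h; rewrite h2].
  by exists r1; [left|].
have chphi' : ~ (sat (bt y _ (rk \o s)) phi <-> sat (bt y _ (rk \o t)) phi).
  by rewrite e1 e2.
have chpsi' : ~ (sat (bt y _ (far \o s')) psi <-> sat (bt y _ (far \o t')) psi).
  by rewrite e3 e4.
pose u (x : 'I_k) := (N.+1 + x)%N.
pose w (x : 'I_l) := (N.+1 + k + N.+1 + x)%N.
have [r hr chr] := pick _ _ _ _ u chphi'.
have [r' hr' chr'] := pick _ _ _ _ w chpsi'.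
have [rinc rN] : increasing r /\ forall x, (r x <= N)%N.
  by case: hr => ->; split=> [|x]; rewrite ?rkX //; apply inc_rk.
have [r'inc r'N] : increasing r' /\ forall x, (N.+1 + k <= r' x <= N.+1 + k + N)%N.
  by case: hr' => ->; split=> [|x]; [apply inc_rk|rewrite /= /far !leq_add2l leq_addr rkX
    |apply inc_rk|rewrite /= /far !leq_add2l leq_addr rkX].
pose B := (k + l)%N.
pose g n i (x : 'I_n) := (i * B + x)%N.
have rE x x' : (r x < r x')%N = (x < x')%N by have := increasing_lt rinc x x'; rewrite ltEnat.
have r'E x x' : (r' x < r' x')%N = (x < x')%N by have := increasing_lt r'inc x x'; rewrite ltEnat.
have pat2 z z' : (glue nat r u r' w z < glue nat r u r' w z')%O =
    (glue nat (g k 0) (g k 1) (g l 2) (g l 3) z <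
     glue nat (g k 0) (g k 1) (g l 2) (g l 3) z')%N.
  rewrite ltEnat.
  by case: z => [[x|x]|[x|x]]; case: z' => [[x'|x']|[x'|x']];
    rewrite /= /u /w /g /B ?rE ?r'E; have := ltn_ord x; have := ltn_ord x';
    try have := rN x; try have := rN x'; try have := r'N x; try have := r'N x'; lia.
have [y' [e1' e2' e3' e4']] := @transfer _ nat b y _ _ _ _ _ _ _ _ indb pat2.
pose bb i (z : 'I_B * V) := b (i * B + z.1)%N z.2.
have indbb : same_em bb bb.
  move=> n p q q' hq hq'.
  pose flat (f : 'I_n -> nat) (z : 'I_n * 'I_B) := (f z.1 * B + z.2)%N.
  have flatE f : increasing f -> forall z z', (flat f z < flat f z')%N =
      ((z.1 < z'.1)%N || (z.1 == z'.1) && (z.2 < z'.2)%N).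
    move=> hf [x1 x2] [x1' x2']; rewrite /flat /= -(increasing_lt hf) ltEnat.
    rewrite -(inj_eq val_inj) /=; have := ltn_ord x2; have := ltn_ord x2' => h' h.
    have mono (i j : nat) : (i < j)%N -> (i.+1 * B <= j * B)%N.
      by rewrite leq_mul2r => ->; rewrite orbT.
    case: (ltngtP x1 x1') => [/hf|/hf|/val_inj ->].
    - by rewrite ltEnat => hlt; have := mono _ _ hlt; lia.
    - by rewrite ltEnat => hlt; have := mono _ _ hlt; lia.
    - by rewrite ltn_add2l ltnn.
  have := @order_transfer _ U _ _ nat nat V b b _ (flat q) (flat q')
    (fmap p (fun z => ((z.1, z.2.1), z.2.2))) indb.
  rewrite !sat_fmap; apply => z z'.
  by rewrite ltEnat /= (flatE _ hq) (flatE _ hq').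
pose phi2 := fmap phi (omap (fun z : 'I_k * V => (widen_ord (leq_addr l k) z.1, z.2))).
pose psi2 := fmap psi (omap (fun z : 'I_l * V => (widen_ord (leq_addl k l) z.1, z.2))).
have phi2E i : sat (oapp (bb i) y') phi2 = sat (bt y' _ (g k i)) phi.
  by rewrite sat_fmap; congr sat; apply: funext => -[].
have psi2E i : sat (oapp (bb i) y') psi2 = sat (bt y' _ (g l i)) psi.
  by rewrite sat_fmap; congr sat; apply: funext => -[].
have := @no_two_changes _ _ Tcomplete _ _ monsterU dpT _ bb indbb phi2 psi2 y' 0 1 2 3 isT isT.
rewrite !phi2E !psi2E e1' e2' e3' e4' => h.
by apply: chr'; exact: h chr.
Qed.
End Stretch.

(** * From two changes to a partition *)

Lemma indiscernible_same_em L (M : structure L) (d : Order.disp_t) (I : orderType d)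
    m (a : I -> 'I_m -> M) : indiscernible a <-> same_em a a.
Proof.
have satl k (p : formula L ('I_k * 'I_m)) v :
    tp (@par0 L M) v (fmap p inl) = sat v p.
  by rewrite /tp /mkset sat_fmap; congr sat; apply: funext.
split=> [ind k p s t hs ht|ind k s t hs ht _ _].
  by rewrite -!satl; congr (_ _); apply: ind.
apply: funext => p.
pose p' := fmap p (fun z : 'I_k * 'I_m + void =>
  match z with inl y => y | inr x => of_void _ x end).
have E v : tp (@par0 L M) v p = sat v p'.
  rewrite /tp /mkset /p' sat_fmap; congr sat.
  by apply: funext => -[|[]].
by rewrite !E; exact: ind.
Qed.

Lemma sat_sum_val L (M : structure L) (W : Type) (v : W -> M) c
    (p : formula L (W + unit)) :
  sat (sum_val v (par1 c)) p =
  sat (oapp v c) (fmap p (fun z => if z is inl y then Some y else None)).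
Proof. by rewrite sat_fmap; congr sat; apply: funext => -[]. Qed.

Lemma indiscernible_on_subsingleton L (M : structure L) (P : Type) (e : P -> M)
    (d : Order.disp_t) (I : orderType d) (J : set I) m (a : I -> 'I_m -> M) :
  (forall i j, J i -> J j -> i = j) -> indiscernible_on e J a.
Proof.
move=> J1 k s t _ _ sJ tJ; suff -> : s = t by [].
by apply: funext => x; exact: J1.
Qed.

Lemma finite_singletons_partition (d : Order.disp_t) (I : orderType d) :
  finite_set [set: I] -> exists n (Q : 'I_n.+1 -> set I),
    [/\ convex_partition Q, at_most_two_infinite Q &
        forall l i j, Q l i -> Q l j -> i = j].
Proof.
move=> /[dup] finI /finite_seqP [s sE].
have sin i : i \in s by have : [set` s] i by rewrite -sE.
exists (size s), (fun l => [set i | index i s = l]).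
have Q1 l i j : index i s = l -> index j s = l -> i = j.
  by move=> hi hj; rewrite -(nth_index i (sin i)) hi -hj nth_index.
split=> [|| l i j]; last exact: Q1.
  split.
  - apply/seteqP; split=> // i _.
    have hi : (index i s < (size s).+1)%N by rewrite ltnS index_size.
    by exists (Ordinal hi).
  - by move=> l l' _ _ [i [/= h h']]; apply: val_inj; rewrite /= -h -h'.
  - move=> l i j k hi hk /andP [ij jk]; suff -> : j = i by [].
    by apply: le_anti; rewrite ij (Q1 _ _ _ hi hk) jk.
rewrite /at_most_two_infinite (_ : [set _ | _]%SET = finset.set0) ?cards0 //.
apply/setP => l; rewrite !inE; apply/asboolP => h; apply: h.
by apply: sub_finite_set finI.
Qed.

Lemma not_indiscernible_on L (M : structure L) (c : M)
    (d : Order.disp_t) (I : orderType d) (J : set I) m (a : I -> 'I_m -> M) :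
  ~ indiscernible_on (par1 c) J a ->
  exists k (s t : 'I_k -> I) (p : formula L (option ('I_k * 'I_m))),
    [/\ increasing s, increasing t, forall x, J (s x), forall x, J (t x) &
        ~ (sat (oapp (fun z => a (s z.1) z.2) c) p <->
           sat (oapp (fun z => a (t z.1) z.2) c) p)].
Proof.
move=> h; apply: contrapT => h'; apply: h => k s t hs ht sJ tJ.
apply: funext => p; apply/propext; rewrite /tp /mkset !sat_sum_val.
by apply: contrapT => hp; apply: h'; exists k, s, t; eexists; split; eauto.
Qed.

Section Equivalence.
Variables (L : language) (T : theory L) (Tcomplete : complete T).
Variables (K : Type) (U : structure L) (monsterU : monster K T U).

(** [A] and [B] are the largest initial and final segments that are
    indiscernible over [c]. An index [i] outside both is the end of a bad initial
    segment and the start of a bad final segment, so two such indices [i < j]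
    would give disjoint bad segments, that is, two changes. *)
Lemma dp_minimal_partition (d : Order.disp_t) (I : orderType d) m
    (a : I -> 'I_m -> U) (c : U) : dp_minimal T -> indiscernible a ->
  exists (n : nat) (Q : 'I_n.+1 -> set I),
    [/\ convex_partition Q, at_most_two_infinite Q &
        forall l : 'I_n.+1, indiscernible_on (par1 c) (Q l) a].
Proof.
move=> dpT /indiscernible_same_em inda.
case: (pselect (finite_set [set: I])) => [finI|infI].
  have [n [Q [Q1 Q2 Q3]]] := finite_singletons_partition finI.
  by exists n, Q; split=> // l; apply: indiscernible_on_subsingleton => i j; exact: Q3.
pose good J := indiscernible_on (par1 c) J a.
pose A : set I := [set i | good [set j | (j <= i)%O]].
pose B : set I := [set i | good [set j | (i <= j)%O]].
have Ale i j : A i -> (j <= i)%O -> A j.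
  move=> Ai ji k s t hs ht sj tj; apply: Ai => // x;
    [exact: le_trans (sj x) ji|exact: le_trans (tj x) ji].
have Bge i j : B i -> (i <= j)%O -> B j.
  move=> Bi ij k s t hs ht sj tj; apply: Bi => // x;
    [exact: le_trans ij (sj x)|exact: le_trans ij (tj x)].
have goodA : good A.
  move=> [|k] s t hs ht sA tA.
    by congr tp; apply: funext => -[[n hn] z]; have := hn; rewrite ltn0.
  have sm (r : 'I_k.+1 -> I) (hr : increasing r) x : (r x <= r ord_max)%O.
    by rewrite leNgt (increasing_lt hr) -leqNgt -ltnS.
  case: (leP (s ord_max) (t ord_max)) => st.
    by apply: (tA ord_max) => // x /=; rewrite ?sm // (le_trans (sm _ hs x)).
  by apply: (sA ord_max) => // x /=; rewrite ?sm // (le_trans (sm _ ht x)) // ltW.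
have goodB : good B.
  move=> [|k] s t hs ht sB tB.
    by congr tp; apply: funext => -[[n hn] z]; have := hn; rewrite ltn0.
  have sm (r : 'I_k.+1 -> I) (hr : increasing r) x : (r ord0 <= r x)%O.
    by rewrite leNgt (increasing_lt hr).
  case: (leP (s ord0) (t ord0)) => st.
    by apply: (sB ord0) => // x /=; rewrite ?sm // (le_trans st) ?sm.
  by apply: (tB ord0) => // x /=; rewrite ?sm // (le_trans (ltW st)) ?sm.
have AB1 i j : ~ A i -> ~ B i -> ~ A j -> ~ B j -> i = j.
  have lt i' j' : ~ A i' -> ~ B j' -> ~ (i' < j')%O.
    move=> /not_indiscernible_on [k [s [t [p [hs ht sJ tJ hp]]]]].
    move=> /not_indiscernible_on [l [s' [t' [q [hs' ht' sJ' tJ' hq]]]]] ij.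
    apply: hq.
    apply: (@no_two_tuple_changes _ _ Tcomplete _ _ monsterU dpT _ _ _ a c i' _ _ s t s' t'
      p q infI inda hs ht hs' ht' sJ tJ _ _ hp).
      by move=> x; apply: lt_le_trans ij (sJ' x).
    by move=> x; apply: lt_le_trans ij (tJ' x).
  by move=> Ai Bi Aj Bj; case: (ltgtP i j) => // h; [case: (lt i j)|case: (lt j i)].
pose Q (l : 'I_3) : set I :=
  match val l with 0%N => A | 1%N => B `\` A | _ => ~` (A `|` B) end.
have Q2 i j : Q ord_max i -> Q ord_max j -> i = j.
  by rewrite /Q /= => /not_orP [Ai Bi] /not_orP [Aj Bj]; exact: AB1.
exists 2%N, Q; split.
- split.
  + apply/seteqP; split=> // i _.
    case: (pselect (A i)) => Ai; first by exists ord0.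
    case: (pselect (B i)) => Bi; first by exists (@Ordinal 3 1 isT).
    by exists ord_max => //; rewrite /Q /= => -[].
  + move=> l l' _ _ [i []]; case: l => -[|[|[|//]]] ?; case: l' => -[|[|[|//]]] ?;
      rewrite /Q /= => h h'; try exact: val_inj; exfalso;
      move: h h'; rewrite /setC /setU /setD /=; tauto.
  + move=> l i j k; case: l => -[|[|[|//]]] hl; rewrite /Q /=.
    * by move=> _ Ak /andP [_ jk]; exact: Ale jk.
    * move=> [Bi nAi] [Bk nAk] /andP [ij jk]; split; first exact: Bge ij.
      by move=> Aj; apply: nAi; exact: Ale ij.
    * move=> Qi Qk /andP [ij jk]; suff -> : j = i by [].
      apply: le_anti; rewrite ij andbT; suff -> : i = k by [].
      exact: (Q2 i k).
- rewrite /at_most_two_infinite.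
  apply: (@leq_trans #|[set~ (ord_max : 'I_3)]%SET|); last by rewrite cardsC1 card_ord.
  apply: subset_leq_card; apply/fintype.subsetP => l; rewrite !inE => infl.
  apply/eqP => lE; apply: infl; rewrite lE.
  case: (pselect (exists i, Q ord_max i)) => [[i Qi]|h].
    by apply: (sub_finite_set (B := [set i]%classic)) => // j Qj; exact: Q2.
  apply: (sub_finite_set (B := classical_sets.set0)) => // i Qi.
  by apply: h; exists i.
- move=> -[[|[|[|//]]] hl]; rewrite /Q /=; first exact: goodA.
    by move=> k s t hs ht sJ tJ; apply: goodB => // x; [have [] := sJ x|have [] := tJ x].
  by apply: indiscernible_on_subsingleton => i j; exact: Q2.
Qed.
End Equivalence.

Lemma indiscernible_on_tp L (M : structure L) (P : Type) (e : P -> M)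
    (d : Order.disp_t) (I : orderType d) (J : set I) m (a : I -> 'I_m -> M) i j :
  indiscernible_on e J a -> J i -> J j -> tp e (a i) = tp e (a j).
Proof.
move=> ind Ji Jj; apply: funext => p.
pose p' := fmap p (fun z => match z with inl x => inl (ord0 : 'I_1, x) | inr u => inr u end).
have E h : tp e (a h) p = tp e (fun z : 'I_1 * 'I_m => a h z.2) p'.
  by rewrite /tp /mkset sat_fmap; congr sat; apply: funext => -[].
rewrite !E.
have := ind 1%N (fun=> i) (fun=> j) _ _ (fun=> Ji) (fun=> Jj).
by move=> -> // x y; rewrite !ord1.
Qed.

(** * Ramsey's theorem *)

Definition unbounded (A : set nat) : Prop := forall n, exists2 m, (n < m)%N & A m.

(** [P] does not distinguish the increasing [k]-tuples from [A]. *)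
Definition homogeneous k (P : seq nat -> Prop) (A : set nat) : Prop :=
  exists c : Prop, forall s, size s = k -> sorted ltn s ->
    (forall x, x \in s -> A x) -> (P s <-> c).

(** The usual descent: choose points one by one, each time shrinking the set in
    which the later points are taken so that the truth value of [P] at a tuple
    depends only on its first point; then keep the points with the same value. *)
Lemma ramsey k (P : seq nat -> Prop) (A : set nat) : unbounded A ->
  exists B, [/\ unbounded B, B `<=` A & homogeneous k P B].
Proof.
elim: k P A => [|k IH] P A unbA.
  by exists A; split=> //; exists (P [::]) => -[].
have step (C : set nat) : exists r : nat * set nat * Prop, unbounded C ->
    [/\ C r.1.1, unbounded r.1.2, r.1.2 `<=` [set y | C y /\ (r.1.1 < y)%N] &
      forall s, size s = k -> sorted ltn s -> (forall x, x \in s -> r.1.2 x) ->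
        (P (r.1.1 :: s) <-> r.2)].
  case: (pselect (unbounded C)) => [unbC|h]; last by exists (0%N, C, True).
  have [x _ Cx] := unbC 0%N.
  have unbC' : unbounded [set y | C y /\ (x < y)%N].
    move=> n; have [m hm Cm] := unbC (maxn n x); exists m; first by lia.
    by split=> //; lia.
  have [B [unbB BC [c hc]]] := IH (fun s => P (x :: s)) _ unbC'.
  by exists (x, B, c).
pose F C := projT1 (cid (step C)).
have FP C (unbC : unbounded C) := projT2 (cid (step C)) unbC.
rewrite -/(F _) in FP.
pose C := fix C n := if n is n'.+1 then (F (C n')).1.2 else A.
have unbC n : unbounded (C n) by elim: n => //= n /FP [].
pose x n := (F (C n)).1.1.
have Csub n j : (n <= j)%N -> C j `<=` C n.
  move=> /subnKC <-; elim: (j - n)%N => [|i IHi]; first by rewrite addn0.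
  rewrite addnS /= => y; have [_ _ h _] := FP _ (unbC (n + i)%N).
  by move/h => [/IHi].
have xC n j : (n < j)%N -> C n.+1 (x j).
  by move=> nj; apply: (Csub _ _ nj); have [] := FP _ (unbC j).
have xlt n j : (n < j)%N -> (x n < x j)%N.
  by move=> /xC /= h; have [_ _ h' _] := FP _ (unbC n); have [] := h' _ h.
have xge n : (n <= x n)%N.
  by elim: n => // n /leq_ltn_trans; apply; exact: xlt.
have [D [c [unbD hD]]] : exists (D : set nat) (c : Prop), unbounded D /\
    forall n, D n -> ((F (C n)).2 <-> c).
  case: (pselect (unbounded [set n | (F (C n)).2])) => [u|nu].
    by exists [set n | (F (C n)).2], True; split=> // n.
  exists [set n | ~ (F (C n)).2], False; split=> //.
  move=> n; apply: contrapT => h; apply: nu => n'.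
  have h' j : (n < j)%N -> (F (C j)).2.
    by move=> nj; apply: contrapT => hj; apply: h; exists j.
  by exists (n + n').+1; [lia|apply: (h' (n + n').+1); lia].
exists [set y | exists2 n, D n & y = x n]; split.
- move=> n; have [m nm Dm] := unbD n; exists (x m); last by exists m.
  exact: leq_trans nm (xge m).
- by move=> y [n _ ->]; apply: (Csub 0%N n) => //; have [] := FP _ (unbC n).
exists c => -[//|y s] [sk] ys hs.
have [n Dn yE] := hs y (mem_head _ _).
have [_ _ _ hP] := FP _ (unbC n); rewrite -(hD _ Dn) yE; apply: hP => //.
  exact: path_sorted ys.
move=> z zs; have [j Dj zE] := hs z (mem_behead (s := y :: s) zs).
have yz : (y < z)%N by have /allP := order_path_min ltn_trans ys; apply.
rewrite zE; apply: xC; rewrite ltnNge; apply/negP; rewrite leq_eqVlt => /orP [/eqP jn|/xlt].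
  by move: yz; rewrite yE zE jn ltnn.
by rewrite -yE -zE; lia.
Qed.

Lemma ramsey_list (D : seq (nat * (seq nat -> Prop))) (A : set nat) : unbounded A ->
  exists B, [/\ unbounded B, B `<=` A &
    forall k P, List.In (k, P) D -> homogeneous k P B].
Proof.
elim: D A => [|[k P] D IH] A unbA; first by exists A; split=> //; move=> k P [].
have [B [unbB BA hB]] := ramsey k P unbA.
have [C [unbC CB hC]] := IH _ unbB.
exists C; split=> // [x /CB /BA //|k' P' [[<- <-]|]]; last exact: hC.
have [c hc] := hB; exists c => s sk ss sC; apply: hc => // x xs.
by apply: CB; exact: sC.
Qed.

Lemma unbounded_enum (A : set nat) : unbounded A ->
  exists2 H : nat -> nat, {homo H : i j / (i < j)%N} & forall n, A (H n).
Proof.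
move=> unbA.
have [f hf] : {f : nat -> nat | forall n, (n < f n)%N /\ A (f n)}.
  have h n : exists m, (n < m)%N /\ A m by have [m] := unbA n; exists m.
  by exists (fun n => projT1 (cid (h n))) => n; exact: (projT2 (cid (h n))).
exists (fun n => iter n f (f 0%N)).
  by apply: homo_ltn => [y x z|i]; [exact: ltn_trans|have [] := hf (iter i f (f 0%N))].
by case=> [|n] /=; exact: (hf _).2.
Qed.

(** * From an ICT pattern to an indiscernible sequence with two special terms *)

Lemma elementary_sat L (M N : structure L) (h : M -> N) (Z : finType) (v : Z -> M)
    (p : formula L Z) : elementary h -> sat v p <-> sat (h \o v) p.
Proof.
move=> hel; have E (S : structure L) (w : Z -> S) :
    sat (w \o enum_val) (fmap p enum_rank) = sat w p.
  by rewrite sat_fmap; congr sat; apply: funext => z /=; rewrite enum_rankK.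
by rewrite -E -(E _ (h \o v)); exact: hel.
Qed.

Lemma elementary_model L (T : theory L) (M N : structure L) (h : M -> N) :
  elementary h -> is_model T M -> is_model T N.
Proof.
move=> hel hM s /hM; rewrite /models => hs.
have := (elementary_sat (of_void M) s hel).1 hs.
by congr sat; apply: funext => -[].
Qed.

Lemma nth_codom_ord (k : nat) (f : 'I_k -> nat) (x : 'I_k) :
  nth 0%N [seq f i | i <- enum 'I_k] x = f x.
Proof. by rewrite (nth_map x) ?size_enum_ord // nth_ord_enum. Qed.

Lemma sorted_codom_ord (k : nat) (f : 'I_k -> nat) :
  (forall x y : 'I_k, (x < y)%N -> (f x < f y)%N) ->
  sorted ltn [seq f i | i <- enum 'I_k].
Proof.
move=> hf; apply: (@homo_sorted _ _ _ (relpre val ltn)) => //.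
by rewrite -sorted_map val_enum_ord iota_ltn_sorted.
Qed.

Section Converse.
Variables (L : language) (T : theory L) (Tcomplete : complete T).
Variables (K : Type) (U : structure L) (monsterU : monster K T U).

Local Notation J := (nat *l nat)%type.

(** Ramsey's theorem makes any finite part of the required type realisable by
    terms of the pattern itself; the first sequence is indexed by [true], the
    second by [false]. *)
Lemma ICT_indiscernible (M : structure L) m (phi psi : formula L (option 'I_m))
    (a b : nat -> 'I_m -> M) (q0 q1 : J) :
  is_model T M -> ICT_pattern phi psi a b ->
  exists (e : J -> bool * 'I_m -> U) (c : U), same_em e e /\ forall q,
    (sat (oapp (fun z => e q (true, z)) c) phi <-> q = q0) /\
    (sat (oapp (fun z => e q (false, z)) c) psi <-> q = q1).
Proof.
move=> hM ict.
pose V : finType := (bool * 'I_m)%type.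
pose W : countType := option (J * V).
pose ab (n : nat) (z : V) := if z.1 then a n z.2 else b n z.2.
pose at_ (s : bool) (q : J) (o : option 'I_m) : W := omap (fun z => (q, (s, z))) o.
pose tup k (s : 'I_k -> J) (z : 'I_k * V) : W := Some (s z.1, z.2).
pose trace k (p : formula L ('I_k * V)) (s : seq nat) :=
  sat (fun z : 'I_k * V => ab (nth 0%N s z.1) z.2) p.
pose Sig (D : seq (nat * (seq nat -> Prop)) * seq J) (f : formula L W) :=
  (exists k (p : formula L ('I_k * V)) (s t : 'I_k -> J),
     [/\ increasing s /\ increasing t, List.In (k, trace k p) D.1,
         forall x, s x \in D.2, forall x, t x \in D.2 &
         f = Iff (fmap p (tup k s)) (fmap p (tup k t))]) \/
  (exists2 q, q \in D.2 & [\/ q = q0 /\ f = fmap phi (at_ true q),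
     q <> q0 /\ f = Neg (fmap phi (at_ true q)),
     q = q1 /\ f = fmap psi (at_ false q) |
     q <> q1 /\ f = Neg (fmap psi (at_ false q))]).
have [|v hv] := @realize L T Tcomplete K U monsterU W [set f | exists D, Sig D f].
  move=> l hl.
  have [||[D X] hDX] := @Forall_directed _ _ Sig ([::], [::])
      (fun d d' => (d.1 ++ d'.1, d.2 ++ d'.2)) l _ _ hl.
  - move=> [D X] [D' X'] f [[k [p [s [t [st h hs ht ->]]]]]|[q hq hf]]; [left|right].
      exists k, p, s, t; split=> //=; first by apply: List.in_or_app; left.
        by move=> x; rewrite mem_cat hs.
      by move=> x; rewrite mem_cat ht.
    by exists q => //=; rewrite mem_cat hq.
  - move=> [D X] [D' X'] f [[k [p [s [t [st h hs ht ->]]]]]|[q hq hf]]; [left|right].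
      exists k, p, s, t; split=> //=; first by apply: List.in_or_app; right.
        by move=> x; rewrite mem_cat hs orbT.
      by move=> x; rewrite mem_cat ht orbT.
    by exists q => //=; rewrite mem_cat hq orbT.
  have unbN : unbounded [set: nat] by move=> n; exists n.+1.
  have [A [unbA _ hA]] := ramsey_list D unbN.
  have [H Hinc HA] := unbounded_enum unbA.
  pose X' := [:: q0, q1 & X].
  pose f q := H (rank X' q).
  have finc q q' : q \in X' -> q' \in X' -> (f q < f q')%N = (q < q')%O.
    move=> hq hq'; rewrite -(rank_lt hq hq').
    by apply: leqW_mono; apply: leq_mono.
  have finj q q' : q \in X' -> q' \in X' -> f q = f q' -> q = q'.
    move=> hq hq' E; apply: le_anti; rewrite !leNgt -(finc _ _ hq hq') -(finc _ _ hq' hq).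
    by rewrite E ltnn.
  have [N [h [hel [x [x1 x2 x3 x4]]]]] := ict (f q0) (f q1).
  (* the extension [N] serves as the model, since [x] need not be in [M] *)
  exists N, (fun w => if w is Some (q, z) then h (ab (f q) z) else x).
  split; first exact: elementary_model hM.
  set v := (fun w => _).
  have vat s q : v \o at_ s q = oapp (h \o (if s then a else b) (f q)) x.
    by apply: funext => -[z|] //=; rewrite /ab; case: s.
  have XX' q : q \in X -> q \in X' by rewrite !inE => ->; rewrite !orbT.
  apply: List.Forall_impl hDX => g [[k [p [s [t [[hs ht] pD sX tX ->]]]]]|[q qX]].
    rewrite sat_Iff !sat_fmap.
    have [cl hcl] := hA _ _ pD.
    have E r : increasing r -> (forall x, r x \in X) -> sat (v \o tup k r) p <-> cl.
      move=> hr rX.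
      have := hcl [seq f (r i) | i <- enum 'I_k].
      rewrite size_map size_enum_ord => /(_ erefl) {}hcl.
      rewrite -hcl.
      + rewrite /trace (elementary_sat _ _ hel).
        suff -> : v \o tup k r = h \o (fun z : 'I_k * V =>
          ab (nth 0%N [seq f (r i) | i <- enum 'I_k] z.1) z.2) by [].
        by apply: funext => z /=; rewrite nth_codom_ord.
      + apply: sorted_codom_ord => y z /hr; rewrite finc //; exact: XX'.
      + by move=> y /mapP [i _ ->]; exact: HA.
    by rewrite (E _ hs sX) (E _ ht tX).
  have hq := XX' _ qX.
  have hq0 : q0 \in X' by rewrite !inE eqxx.
  have hq1 : q1 \in X' by rewrite !inE eqxx orbT.
  case=> -[hqq ->]; rewrite ?sat_Neg sat_fmap vat.
  - by rewrite hqq.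
  - by apply: x3 => /(finj _ _ hq hq0).
  - by rewrite hqq.
  - by apply: x4 => /(finj _ _ hq hq1).
exists (fun q z => v (Some (q, z))), (v None); split.
  move=> k p s t hs ht.
  have := hv (Iff (fmap p (tup k s)) (fmap p (tup k t))).
  rewrite sat_Iff !sat_fmap => h; apply/propext; apply: h.
  exists ([:: (k, trace k p)], codom s ++ codom t); left; exists k, p, s, t; split=> //=.
  - by left.
  - by move=> x; rewrite mem_cat codom_f.
  - by move=> x; rewrite mem_cat codom_f orbT.
move=> q.
have vat s : v \o at_ s q = oapp (fun z => v (Some (q, (s, z)))) (v None).
  by apply: funext => -[].
have hvq f : [\/ q = q0 /\ f = fmap phi (at_ true q),
     q <> q0 /\ f = Neg (fmap phi (at_ true q)),
     q = q1 /\ f = fmap psi (at_ false q) |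
     q <> q1 /\ f = Neg (fmap psi (at_ false q))] -> sat v f.
  move=> hf; apply: hv; exists ([::], [:: q]); right; exists q => //=.
  by rewrite inE.
split; rewrite -vat -sat_fmap; split=> [h|qE].
- by apply: contrapT => nq; apply: (hvq (Neg (fmap phi (at_ true q)))); first constructor 2.
- by apply: hvq; constructor 1.
- by apply: contrapT => nq; apply: (hvq (Neg (fmap psi (at_ false q)))); first constructor 4.
- by apply: hvq; constructor 3.
Qed.

(** The points [(1, 0)] and [(2, 0)] cut [nat *l nat] into three infinite
    intervals. *)
Lemma three_intervals n (Q : 'I_n.+1 -> set J) :
  convex_partition Q -> at_most_two_infinite Q ->
  (forall l q, Q l q -> Q l (1, 0)%N -> q = (1, 0)%N) ->
  (forall l q, Q l q -> Q l (2, 0)%N -> q = (2, 0)%N) -> False.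
Proof.
move=> [covQ trivQ convQ] two h1 h2.
have pick (f : nat -> J) : injective f ->
    exists2 l, infinite_set (Q l) & exists i, Q l (f i).
  move=> finj; apply: contrapT => h; apply: infinite_nat.
  apply: (@sub_finite_set _ _ (\bigcup_(l in [set: 'I_n.+1]) (f @^-1` Q l))).
    move=> i _; have : cover [set: 'I_n.+1] Q (f i) by rewrite covQ.
    by move=> [l _ Ql]; exists l.
  apply: bigcup_finite => // l _.
  case: (pselect (finite_set (Q l))) => [finl|infl].
    by apply: finite_preimage finl => x y _ _; exact: finj.
  apply: (@sub_finite_set _ _ set0) => // i Qi.
  by apply: h; exists l => //; exists i.
have [l0 inf0 [i0 Q0]] := pick (fun i => (0, i)%N) ltac:(by move=> ? ? []).
have [l1 inf1 [i1 Q1]] := pick (fun i => (1, i.+1)%N) ltac:(by move=> ? ? []).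
have [l2 inf2 [i2 Q2]] := pick (fun i => (2, i.+1)%N) ltac:(by move=> ? ? []).
have n01 : l0 != l1.
  apply/eqP => e; subst l1.
  have : Q l0 (1, 0)%N by apply: (convQ _ _ _ _ Q0 Q1).
  by move=> /(h1 _ _ Q0).
have n02 : l0 != l2.
  apply/eqP => e; subst l2.
  have : Q l0 (1, 0)%N by apply: (convQ _ _ _ _ Q0 Q2).
  by move=> /(h1 _ _ Q0).
have n12 : l1 != l2.
  apply/eqP => e; subst l2.
  have : Q l1 (2, 0)%N by apply: (convQ _ _ _ _ Q1 Q2).
  by move=> /(h2 _ _ Q1).
move: two; rewrite /at_most_two_infinite leqNgt => /negP; apply.
apply: (@leq_trans #|[set l0; l1; l2]%SET|).
  by rewrite -finset.setUA cardsU1 cards2 !inE negb_or n01 n02 n12.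
apply: subset_leq_card; apply/fintype.subsetP => l.
by rewrite !inE => /orP [/orP [] |] /eqP ->.
Qed.

Lemma partition_dp_minimal :
  (forall (d : Order.disp_t) (I : orderType d) (m : nat)
     (a : I -> 'I_m -> U) (c : U), indiscernible a ->
     exists (n : nat) (Q : 'I_n.+1 -> set I),
       [/\ convex_partition Q, at_most_two_infinite Q &
           forall (l : 'I_n.+1) (i j : I), Q l i -> Q l j ->
             tp (par1 c) (a i) = tp (par1 c) (a j)]) ->
  dp_minimal T.
Proof.
move=> part M hM [m [phi [psi [a [b ict]]]]].
have [e [c [inde he]]] := ICT_indiscernible ((1, 0)%N : J) ((2, 0)%N : J) hM ict.
pose V : finType := (bool * 'I_m)%type.
pose a' q (z : 'I_#|V|) := e q (enum_val z).
have inda' : indiscernible a'.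
  apply/indiscernible_same_em => k p s t hs ht.
  have := inde _ (fmap p (fun z => (z.1, enum_val z.2))) _ _ hs ht.
  by rewrite !sat_fmap.
have [n [Q [Qpart Q2 Qtp]]] := part _ _ _ _ c inda'.
(* a formula on a half of the tuple, read in the type over [c] *)
pose conv s (p : formula L (option 'I_m)) : formula L ('I_#|V| + unit) :=
  fmap p (fun o => if o is Some z then inl (enum_rank ((s, z) : V)) else inr tt).
have convE s p q : tp (par1 c) (a' q) (conv s p) = sat (oapp (fun z => e q (s, z)) c) p.
  rewrite /tp /mkset sat_fmap; congr sat; apply: funext => -[z|] //=.
  by rewrite /a' enum_rankK.
apply: (three_intervals Qpart Q2) => l q Qq Qs.
  by apply/(he q).1; rewrite -convE (Qtp l q _ Qq Qs) convE; apply/(he _).1.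
by apply/(he q).2; rewrite -convE (Qtp l q _ Qq Qs) convE; apply/(he _).2.
Qed.
End Converse.

Theorem fact2p9 (L : language) (T : theory L) (Tcomplete : complete T)
    (K : Type) (U : structure L) (monsterU : monster K T U) :
  [<-> dp_minimal T;
       forall (d : Order.disp_t) (I : orderType d) (m : nat)
         (a : I -> 'I_m -> U) (c : U), indiscernible a ->
         exists (n : nat) (Q : 'I_n.+1 -> set I),
           [/\ convex_partition Q, at_most_two_infinite Q &
               forall (l : 'I_n.+1) (i j : I), Q l i -> Q l j ->
                 tp (par1 c) (a i) = tp (par1 c) (a j)];
       forall (d : Order.disp_t) (I : orderType d) (m : nat)
         (a : I -> 'I_m -> U) (c : U), indiscernible a ->
         exists (n : nat) (Q : 'I_n.+1 -> set I),
           [/\ convex_partition Q, at_most_two_infinite Q &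
               forall l : 'I_n.+1, indiscernible_on (par1 c) (Q l) a]].
Proof.
have weaken (d : Order.disp_t) (I : orderType d) m (a : I -> 'I_m -> U) (c : U) :
    (exists (n : nat) (Q : 'I_n.+1 -> set I),
      [/\ convex_partition Q, at_most_two_infinite Q &
          forall l : 'I_n.+1, indiscernible_on (par1 c) (Q l) a]) ->
    exists (n : nat) (Q : 'I_n.+1 -> set I),
      [/\ convex_partition Q, at_most_two_infinite Q &
          forall (l : 'I_n.+1) (i j : I), Q l i -> Q l j ->
            tp (par1 c) (a i) = tp (par1 c) (a j)].
  move=> [n [Q [Q1 Q2 Q3]]]; exists n, Q; split=> // l i j.
  exact: indiscernible_on_tp.
tfae.
- move=> dpT d I m a c ind; apply: weaken.
  exact: (dp_minimal_partition Tcomplete monsterU c dpT ind).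
- move=> part d I m a c ind.
  have dpT := partition_dp_minimal Tcomplete monsterU part.
  exact: (dp_minimal_partition Tcomplete monsterU c dpT ind).
- move=> part; apply: (partition_dp_minimal Tcomplete monsterU) => d I m a c ind; apply: weaken.
  exact: part ind.
Qed.
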